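(* Let $G$ be a group and let $n\ge 1$ be an integer. Let $\delta_G$ and $\iota_G$ be the discrete and the indiscrete topology on $G$, respectively. Then $id_G:(G,\delta_G)\to(G,\iota_G)$ is $n$-step semitopological if and only if $G$ is nilpotent of class $\le n$.
   Context: Group topologies are not assumed Hausdorff. A continuous group isomorphism $f:(G,\tau)\to(H,\sigma)$ of topological groups is semitopological if there exist a topological group $(\widetilde G,\widetilde\tau)$ containing $G$ as a normal subgroup with $\widetilde\tau$ inducing $\tau$ on $G$, and an open continuous homomorphism $\widetilde f:(\widetilde G,\widetilde\tau)\to(H,\sigma)$ extending $f$. For group topologies $\sigma\le\tau$ on $G$, $id_G:(G,\tau)\to(G,\sigma)$ is $n$-step semitopological if there exist group topologies $\sigma\le\lambda_{n-1}\le\dots\le\lambda_1\le\tau$ on $G$ such that, with $\lambda_0=\tau$ and $\lambda_n=\sigma$, each $id_G:(G,\lambda_{i-1})\to(G,\lambda_i)$, $1\le i\le n$, is semitopological. With $\gamma_1(G)=G$ and $\gamma_{k}(G)=[G,\gamma_{k-1}(G)]$ for $k\ge 2$, ''nilpotent of class $\le n$'' means $\gamma_{n+1}(G)=\{e_G\}$. *)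

(* Defs.v *)
From HB Require Import structures.
From mathcomp Require Import all_boot all_classical topology.

Set Implicit Arguments.
Unset Strict Implicit.
Unset Printing Implicit Defensive.

Local Open Scope classical_set_scope.
Local Open Scope group_scope.

HB.structure Definition PreTopologicalGroup := {G of Topological G & Group G}.

HB.mixin Record PreTopologicalGroup_isTopologicalGroup G
    & PreTopologicalGroup G := {
  mulg_continuous : continuous (fun x : G * G => x.1 * x.2) ;
  invg_continuous : continuous (fun x : G => x^-1)
}.

#[short(type="topologicalGroupType")]
HB.structure Definition TopologicalGroup :=
  {G of PreTopologicalGroup G & PreTopologicalGroup_isTopologicalGroup G}.

(* [Gt] contains [G] as a normal subgroup up to the injective morphism [i]. *)
Definition normal_embedding (G Gt : groupType) (i : G -> Gt) : Prop :=
  [/\ {morph i : x y / x * y}, injective i &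
      forall (g : G) (x : Gt), range i (i g ^ x)].

Definition induces_topology (S T : topologicalType) (i : S -> T) : Prop :=
  forall A : set S, open A <-> exists2 B : set T, open B & i @^-1` B = A.

Definition open_map (S T : topologicalType) (f : S -> T) : Prop :=
  forall A : set S, open A -> open (f @` A).

Definition continuous_isomorphism (G H : topologicalGroupType) (f : G -> H) :
    Prop :=
  [/\ {morph f : x y / x * y}, bijective f & continuous f].

Definition semitopological (G H : topologicalGroupType) (f : G -> H) : Prop :=
  continuous_isomorphism f /\
  exists (Gt : topologicalGroupType) (i : G -> Gt) (ft : Gt -> H),
    [/\ normal_embedding i,
        induces_topology i,
        {morph ft : x y / x * y},
        continuous ft /\ open_map ft &
        forall g : G, ft (i g) = f g].

(* Several topologies are carried by the same group, so a topology is here a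
   first-class family of open sets, and [with_topology tau] is the carrier
   equipped with [tau]. *)
Record topology_on (T : Type) := TopologyOn {
  opens : set (set T) ;
  opens_setT : opens setT ;
  opens_setI : setI_closed opens ;
  opens_bigcup : forall F : set (set T),
    F `<=` opens -> opens (\bigcup_(A in F) A)
}.

Definition with_topology (T : Type) (tau : topology_on T) : Type := T.

Section WithTopology.
Variables (T : choiceType) (tau : topology_on T).

Let opens_bigcup_ind (I : Type) (f : I -> set T) :
  (forall i, opens tau (f i)) -> opens tau (\bigcup_i f i).
Proof.
move=> tauf; rewrite -(bigcup_image setT f id).
by apply: opens_bigcup => _ [i _ <-].
Qed.

HB.instance Definition _ := Choice.on (with_topology tau).
HB.instance Definition _ := isOpenTopological.Build (with_topology tau)
  (opens_setT tau) (@opens_setI _ tau) opens_bigcup_ind.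
End WithTopology.

HB.instance Definition _ (G : groupType) (tau : topology_on G) :=
  Group.on (with_topology tau).

Record group_topology (G : groupType) := GroupTopology {
  group_topology_on :> topology_on G ;
  group_topology_mul : continuous
    (fun x : with_topology group_topology_on * with_topology group_topology_on
       => x.1 * x.2) ;
  group_topology_inv : continuous
    (fun x : with_topology group_topology_on => x^-1)
}.

HB.instance Definition _ (G : groupType) (tau : group_topology G) :=
  PreTopologicalGroup_isTopologicalGroup.Build (with_topology tau)
    (@group_topology_mul _ tau) (@group_topology_inv _ tau).

Definition id_between (G : groupType) (tau sigma : group_topology G) :
    with_topology tau -> with_topology sigma := fun x => x.

Arguments id_between {G} tau sigma x.

Definition coarser (G : groupType) (sigma tau : group_topology G) : Prop :=
  opens sigma `<=` opens tau.

Definition step_semitopological (n : nat) (G : groupType)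
    (tau sigma : group_topology G) : Prop :=
  exists lambda : nat -> group_topology G,
    [/\ lambda 0 = tau, lambda n = sigma &
        forall i, (i < n)%N -> coarser (lambda i.+1) (lambda i) /\
          semitopological (id_between (lambda i) (lambda i.+1))].

Section DiscreteIndiscrete.
Variable G : groupType.

Definition discrete_topology_on : topology_on G :=
  @TopologyOn G setT I (fun _ _ _ _ => I) (fun _ _ => I).

Let indiscrete_setI : setI_closed [set A : set G | A = set0 \/ A = setT].
Proof.
by move=> A B [->|->] [->|->]; rewrite ?(set0I, setI0, setTI);
  solve [left; reflexivity | right; reflexivity].
Qed.

Let indiscrete_bigcup (F : set (set G)) :
  F `<=` [set A | A = set0 \/ A = setT] ->
  [set A | A = set0 \/ A = setT] (\bigcup_(A in F) A).
Proof.
move=> FP; have [FT|FnT] := pselect (F setT).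
  by right; apply/seteqP; split => // x _; exists setT.
left; apply/seteqP; split => // x [A FA Ax].
by have [A0|AT] := FP _ FA; [rewrite A0 in Ax | rewrite AT in FA].
Qed.

Definition indiscrete_topology_on : topology_on G :=
  TopologyOn (or_intror erefl) indiscrete_setI indiscrete_bigcup.

Let discrete_nbhs (x : with_topology discrete_topology_on) (A : set G) :
  nbhs x A <-> A x.
Proof.
split=> [|Ax]; first exact: nbhs_singleton.
by rewrite nbhsE; exists A.
Qed.

Let discrete_mul : continuous (fun x : with_topology discrete_topology_on *
  with_topology discrete_topology_on => x.1 * x.2).
Proof.
move=> x A /= /discrete_nbhs Ax; exists ([set x.1], [set x.2]).
  by split; apply/discrete_nbhs.
by move=> [y1 y2] [/= -> ->].
Qed.

Let discrete_inv :
  continuous (fun x : with_topology discrete_topology_on => x^-1).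
Proof. by move=> x A /= /discrete_nbhs Ax; apply/discrete_nbhs. Qed.

Definition discrete_group_topology : group_topology G :=
  GroupTopology discrete_mul discrete_inv.

Let indiscrete_continuous (T : topologicalType)
  (f : T -> with_topology indiscrete_topology_on) : continuous f.
Proof.
apply/continuousP => A [->|->].
  by rewrite preimage_set0; exact: open0.
by rewrite preimage_setT; exact: openT.
Qed.

Definition indiscrete_group_topology : group_topology G :=
  GroupTopology (@indiscrete_continuous _ _) (@indiscrete_continuous _ _).

End DiscreteIndiscrete.

Definition subgroup_set (G : groupType) (A : set G) : Prop :=
  group_closed (mem A).

(* The value at [0] is a convention; the series starts at [1]. *)
Fixpoint gamma {G : groupType} (k : nat) : set G :=
  match k with
  | (_.+1 as k').+1 =>
      smallest (@subgroup_set G)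
        [set [~ x, y] | x in [set: G] & y in gamma k']
  | _ => [set: G]
  end.

Definition nilpotent_of_class_le (G : groupType) (n : nat) : Prop :=
  gamma n.+1 = [set 1 : G].

(* Main.v *)
(** The closure of [1] turns a chain of topologies into a chain of subgroups:
if the identity from [tau] to [sigma] is semitopological, then
[[G, closure_sigma 1]] lies in [closure_tau 1].  Indeed the kernel of an open
extension centralises [G], so [[~ g, w]] depends only on the image of [w] under
it: a neighbourhood of [1] upstairs on which [[~ g, w]] is small has an open
image, on which commutators with [g] are small.  An [n]-step chain from
the discrete to the indiscrete topology thus yields a central series of length
[n].  Conversely, the topologies whose open sets are the unions of cosets of
the terms of the lower central series form such a chain. *)

Require Import Defs.
From mathcomp Require Import all_boot all_classical topology.

Set Implicit Arguments.
Unset Strict Implicit.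
Unset Printing Implicit Defensive.

Local Open Scope classical_set_scope.
Local Open Scope group_scope.

(** * Subgroups and the lower central series *)

Lemma subgroup_setP (G : groupType) (A : set G) :
  subgroup_set A <-> A 1 /\ (forall x y, A x -> A y -> A (x / y)).
Proof.
have memA x : (x \in mem A) = (x \in A) by [].
split=> [[A1 AB]|[A1 AB]]; split.
- by move: A1; rewrite memA inE.
- by move=> x y Ax Ay; move: (AB x y); rewrite !memA !inE; apply.
- by rewrite memA inE.
- by move=> x y; rewrite !memA !inE; exact: AB.
Qed.

Section SubgroupSet.
Variables (G : groupType) (A : set G).
Hypothesis subA : subgroup_set A.

Lemma subgroup_set1 : A 1.
Proof. by have /subgroup_setP[] := subA. Qed.

Lemma subgroup_setV x : A x -> A x^-1.
Proof.
by have /subgroup_setP[A1 AB] := subA; move/(AB _ _ A1); rewrite mul1g.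
Qed.

Lemma subgroup_setM x y : A x -> A y -> A (x * y).
Proof.
have /subgroup_setP[_ AB] := subA.
by move=> Ax /subgroup_setV Ay; rewrite -(invgK y); exact: AB.
Qed.

End SubgroupSet.

Section LowerCentralSeries.
Variable G : groupType.

Lemma subgroup_gamma k : subgroup_set (gamma k : set G).
Proof.
case: k => [|[|k]]; [by apply/subgroup_setP..|].
apply/subgroup_setP; split=> [|x y Ax Ay] B [subB sB].
  exact: subgroup_set1.
have /subgroup_setP[_ BB] := subB.
by apply: BB; [exact: Ax|exact: Ay].
Qed.

Lemma gamma_comm k (g x : G) : gamma k.+1 x -> gamma k.+2 [~ g, x].
Proof. by move=> Gx B [_]; apply; exists g => //; exists x. Qed.

Lemma gamma_smallest k (B : set G) : subgroup_set B ->
  (forall g x, gamma k.+1 x -> B [~ g, x]) -> gamma k.+2 `<=` B.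
Proof.
by move=> subB sB; apply: smallest_sub => // _ [g _ [x Gx <-]]; exact: sB.
Qed.

Lemma gammaS k : gamma k.+1 `<=` (gamma k : set G).
Proof.
elim: k => [//|[//|k] IHk].
apply: gamma_smallest; first exact: subgroup_gamma.
by move=> g x /IHk; exact: gamma_comm.
Qed.

(** A conjugate of [x] is [x] times the inverse of [[~ g, x]], which lies in the next term of the
    series, hence in this one. *)
Lemma gamma_conj k (x g : G) : gamma k x -> gamma k (x ^ g).
Proof.
case: k => [//|k] Gx; rewrite -(mulVKg x (x ^ g)) -commgEl -invgR.
apply: subgroup_setM => //; first exact: subgroup_gamma.
apply: subgroup_setV; first exact: subgroup_gamma.
by apply: gammaS; exact: gamma_comm.
Qed.

End LowerCentralSeries.

(** * From topologies to subgroups: the closure of [1] *)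

Section MorphGroup.
Variables (G H : groupType) (f : G -> H).
Hypothesis fM : {morph f : x y / x * y}.

Lemma morph_group1 : f 1 = 1.
Proof. by apply: (mulgI (f 1)); rewrite -fM !mulg1. Qed.

Lemma morph_groupV : {morph f : x / x^-1}.
Proof. by move=> x; apply: (mulgI (f x)); rewrite -fM !mulgV morph_group1. Qed.

Lemma morph_groupJ : {morph f : x y / x ^ y}.
Proof. by move=> x y; rewrite !conjgE !fM morph_groupV. Qed.

End MorphGroup.

Lemma continuous_mulg (T : topologicalType) (G : topologicalGroupType)
  (f h : T -> G) :
  continuous f -> continuous h -> continuous (fun x => f x * h x).
Proof.
move=> cf ch x; apply: (@continuous2_cvg _ _ _ _ _ _ _ _ (@mul G)).
- exact: (mulg_continuous (f x, h x)).
- exact: cf.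
- exact: ch.
Qed.

Lemma continuous_invg (T : topologicalType) (G : topologicalGroupType)
  (f : T -> G) : continuous f -> continuous (fun x => (f x)^-1).
Proof.
move=> cf x; apply: continuous_comp; first exact: cf.
exact: invg_continuous.
Qed.

Lemma continuous_commg (G : topologicalGroupType) (g : G) :
  continuous (fun w : G => [~ g, w]).
Proof.
have cid : continuous (fun w : G => w) by move=> w; exact: cvg_id.
have ccst (c : G) : continuous (fun _ : G => c) by move=> w; exact: cvg_cst.
apply: continuous_mulg => //; apply: continuous_mulg.
  exact: continuous_invg.
exact: continuous_mulg.
Qed.

(* This is the closure of [1]. *)
Definition core (G : topologicalGroupType) : set G := \bigcap_(U in nbhs 1) U.
Arguments core : clear implicits.

Lemma subgroup_core (G : topologicalGroupType) : subgroup_set (core G).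
Proof.
apply/subgroup_setP; split=> [U /nbhs_singleton//|x y Cx Cy U U1].
have : continuous (fun z : G * G => z.1 / z.2).
  apply: continuous_mulg => [z|]; first exact: cvg_fst.
  by apply: continuous_invg => z; exact: cvg_snd.
move=> /(_ (1, 1) U); rewrite /= divg1 => /(_ U1)[[V W] [/= V1 W1] VW].
by apply: (VW (x, y)); split; [exact: Cx|exact: Cy].
Qed.

Lemma semitopological_core (G H : topologicalGroupType) (f : G -> H) :
  semitopological f ->
  forall g x : G, core H (f x) -> core G [~ g, x].
Proof.
move=> [[fM fbij fC]].
move=> [Gt [i [ft [[iM iinj inorm] itop ftM [ftC ftO] fti]]]] g x Cx.
move=> U; rewrite nbhsE => -[V [oV V1]]; apply.
have [B oB BV] := (itop V).1 oV; rewrite -BV /= in V1 *.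
pose W := (fun w => [~ i g, w]) @^-1` B.
have oW : open W.
  by apply: open_comp => // w _; exact: continuous_commg.
have : core H (f x) by [].
(* The image of [W] is a neighbourhood of [1], so it contains [f x], which lies in all of them. *)
move=> /(_ (ft @` W)) [].
  apply: open_nbhs_nbhs; split; first exact: ftO.
  exists 1; last exact: morph_group1.
  by rewrite /W /= commg1 -(morph_group1 iM).
move=> w Ww ftw.
(* [k] is in the kernel of [ft], hence it centralises [G]. *)
pose k := w * (i x)^-1.
have ftk : ft k = 1 by rewrite ftM (morph_groupV ftM) fti ftw mulgV.
have igk : i g ^ k = i g.
  (* Normality writes [i g ^ k] as [i h]; since [ft] kills [k], [f h = f g], and [f] is
     injective. *)
  have [h _ hE] := inorm g k.
  rewrite -hE; congr i; apply: (bij_inj fbij).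
  by rewrite -!fti hE (morph_groupJ ftM) ftk conjg1.
(* As [w = k * i x] and [k] commutes with [i g], both [w] and [i x] conjugate [i g] alike. *)
suff -> : i [~ g, x] = [~ i g, w] by [].
rewrite !commgEl iM (morph_groupV iM) (morph_groupJ iM); congr (_ * _).
by rewrite -{1}igk -conjgM mulgVK.
Qed.

(** * From subgroups to topologies: unions of cosets *)

Section CosetTopology.
Variables (G : groupType) (N : set G).
Hypotheses (subN : subgroup_set N) (normN : forall x g, N x -> N (x ^ g)).

(** The unions of left cosets of [N], in a form that makes stability under unions and intersections
    immediate. *)
Definition coset_open : set (set G) :=
  [set A | forall x m, A x -> N m -> A (x * m)].

Let coset_openI : setI_closed coset_open.
Proof. by move=> A B oA oB x m [Ax Bx] Nm; split; [exact: oA|exact: oB]. Qed.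

Let coset_open_bigcup (F : set (set G)) :
  F `<=` coset_open -> coset_open (\bigcup_(A in F) A).
Proof.
by move=> oF x m [A FA Ax] Nm; exists A => //; exact: oF Ax Nm.
Qed.

Definition coset_topology_on : topology_on G :=
  @TopologyOn G coset_open (fun _ _ _ _ => I) coset_openI coset_open_bigcup.

Let coset_nbhs (x : with_topology coset_topology_on) (A : set G) :
  nbhs x A <-> forall m, N m -> A (x * m).
Proof.
rewrite nbhsE; split=> [[B [oB Bx] BA] m Nm|xA]; first exact/BA/oB.
exists [set x * m | m in N]; last by move=> _ [m Nm <-]; exact: xA.
split; last by exists 1; [exact: subgroup_set1|rewrite mulg1].
move=> _ p [m Nm <-] Np; exists (m * p); last by rewrite mulgA.
exact: subgroup_setM.
Qed.

Let coset_mul : continuous (fun x : with_topology coset_topology_on *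
  with_topology coset_topology_on => x.1 * x.2).
Proof.
move=> [x y] A /= /coset_nbhs xyA.
exists ([set x * m | m in N], [set y * m | m in N]).
  by split; apply/coset_nbhs => m Nm; exists m.
move=> [_ _] [/= [m Nm <-] [p Np <-]] /=.
have -> : x * m * (y * p) = x * y * (m ^ y * p) by rewrite conjgE !mulgA mulgK.
by apply: xyA; apply: subgroup_setM => //; exact: normN.
Qed.

Let coset_inv :
  continuous (fun x : with_topology coset_topology_on => x^-1).
Proof.
move=> x A /= /coset_nbhs xA; apply/coset_nbhs => m Nm /=.
have -> : (x * m)^-1 = x^-1 * (m^-1 ^ x^-1) by rewrite conjgE mulVKg invgM.
by apply: xA; apply: normN; exact: subgroup_setV.
Qed.

Definition coset_topology : group_topology G :=
  GroupTopology coset_mul coset_inv.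

Lemma opens_coset_topology : opens coset_topology = coset_open.
Proof. by []. Qed.

End CosetTopology.

(** The ends of a chain are compared by equality of records, whose fields other than the open sets
    are proofs. *)
Lemma group_topology_inj (G : groupType) (tau sigma : group_topology G) :
  opens tau = opens sigma -> tau = sigma.
Proof.
case: tau sigma => [[o oT oI oU] tM tV] [[o' oT' oI' oU'] sM sV] /= E.
move: E oT' oI' oU' sM sV => <- oT' oI' oU'.
rewrite (Prop_irrelevance oT' oT) (Prop_irrelevance oI' oI).
rewrite (Prop_irrelevance oU' oU) => sM sV.
by rewrite (Prop_irrelevance sM tM) (Prop_irrelevance sV tV).
Qed.

(* The extension is the first projection of [G * G], where [G] is embedded as
   the first factor and where the pairs of elements of [M] that are congruent
   modulo [N] form an open normal subgroup. *)
Lemma semitopological_coset (G : groupType) (N M : set G)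
  (subN : subgroup_set N) (normN : forall x g, N x -> N (x ^ g))
  (subM : subgroup_set M) (normM : forall x g, M x -> M (x ^ g)) :
  N `<=` M -> (forall g x, M x -> N [~ g, x]) ->
  semitopological (id_between (coset_topology subN normN)
                              (coset_topology subM normM)).
Proof.
move=> NM MN.
have MN' x g : M x -> N (x^-1 * x ^ g).
  by move=> Mx; rewrite -commgEl -invgR; apply: subgroup_setV => //; exact: MN.
pose L : set (G * G) := [set z | [/\ M z.1, M z.2 & N (z.2^-1 * z.1)]].
have subL : subgroup_set L.
  apply/subgroup_setP; split.
    by split; rewrite /= ?mulVg; exact: subgroup_set1.
  move=> [a b] [c d] [/= Ma Mb Nab] [/= Mc Md Ncd].
  split; rewrite /=; [by apply: subgroup_setM => //; exact: subgroup_setV..|].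
  have -> : (b / d)^-1 * (a / c) =
      (b^-1 * a) ^ d^-1 * ((d^-1 * c)^-1 ^ d^-1).
    by rewrite -conjMg conjgE !invgM !invgK !mulgA !mulgK.
  by apply: subgroup_setM => //; apply: normN => //; exact: subgroup_setV.
have normL x g : L x -> L (x ^ g).
  case: x g => [a b] [c d] [/= Ma Mb Nab].
  split; [exact: normM..|].
  (* Conjugation fixes the elements of [M] modulo [N], so the left side is congruent to
     [b^-1 * a]. *)
  have E : (b ^ d)^-1 * a ^ c =
      (b^-1 * b ^ d)^-1 * (b^-1 * a) * (a^-1 * a ^ c).
    by rewrite (invgM b^-1) invgK -[_ * b * _]mulgA mulVKg -mulgA mulVKg.
  change (N ((b ^ d)^-1 * a ^ c)); rewrite E.
  apply: subgroup_setM => //; last exact: MN'.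
  by apply: subgroup_setM => //; apply: subgroup_setV => //; exact: MN'.
split.
  split=> //; first by exists id.
  apply/continuousP => A oA; change (coset_open N A) => x m Ax /NM; exact: oA.
pose Gt := with_topology (coset_topology subL normL).
have openGt (B : set (G * G)) : @open Gt B <-> coset_open L B by [].
have openG K (sK : subgroup_set K) (nK : forall x g, K x -> K (x ^ g))
    (A : set G) : @open (with_topology (coset_topology sK nK)) A <->
  coset_open K A by [].
exists Gt, (fun g => (g, 1)), fst; split=> //.
- split=> [x y|x y []//|g [a b]].
    by change ((x * y, 1) = (x * y, 1 * 1) :> G * G); rewrite mul1g.
  by exists (g ^ a) => //; change ((g ^ a, 1) = (g ^ a, 1 ^ b)); rewrite conj1g.
- move=> A; rewrite openG; split=> [oA|[B /openGt oB <-] x m Bx Nm].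
    (* This is the union of the cosets [(a, 1) * L] with [a] in [A]. Its trace on [G] is [A],
       because [(m, 1)] lies in [L] only for [m] in [N]. *)
    exists [set z | exists2 a, A a & L (a^-1 * z.1, z.2)].
      apply/openGt => -[z1 z2] m [a Aa Laz] Lm; exists a => //.
      have := subgroup_setM subL Laz Lm; rewrite /= mulgA; exact.
    apply/seteqP; split=> [x [a Aa [_ _]]|x Ax] /=.
      change (N (1^-1 * (a^-1 * x)) -> A x).
      by rewrite invg1 mul1g -{2}(mulVKg a x) => Nax; exact: oA.
    by exists x => //; rewrite mulVg; exact: (subgroup_set1 subL).
  have := oB _ (m, 1) Bx.
  change ((x, 1) * (m, 1)) with ((x * m, 1 * 1) : G * G); rewrite mul1g; apply.
  split; rewrite /= ?invg1 ?mul1g//; [exact: NM|exact: subgroup_set1].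
- split.
    apply/continuousP => A /openG oA; apply/openGt => -[x y] [m p] Ax [Mm _ _].
    exact: oA.
  move=> A /openGt oA; apply/openG => _ m [[x y] Axy <-] Mm.
  (* [L] contains the diagonal of [M], so [fst] maps it onto [M]; hence [fst] is open. *)
  exists (x * m, y * m) => //.
  apply: (oA (x, y) (m, m)) => //; split=> //=.
  by rewrite mulVg; exact: subgroup_set1.
Qed.

Theorem theorem7p2 (G : groupType) (n : nat) (hn : (1 <= n)%N) :
  step_semitopological n (discrete_group_topology G) (indiscrete_group_topology G)
  <-> nilpotent_of_class_le G n.
Proof.
split=> [[lambda [l0 ln lS]]|nilG].
  (* Induction from the indiscrete end, where the core is [G]; each step back towards the discrete
     end costs one commutator. *)
  have sub k : (k <= n)%N ->
      gamma k.+1 `<=` (core (with_topology (lambda (n - k)%N)) : set G).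
    elim: k => [_|k IHk kn].
      rewrite subn0 ln => x _ U; rewrite nbhsE => -[V [[->|->] // _]].
      by apply.
    have [|_ lsemi] := lS (n - k.+1)%N; first by rewrite ltn_subrL.
    apply: gamma_smallest; first exact: subgroup_core.
    move=> g x Gx; apply: (semitopological_core lsemi).
    by rewrite -subSn// subSS; apply: (IHk (ltnW kn)).
  apply/seteqP; split=> [x|_ ->]; last first.
    exact: (subgroup_set1 (subgroup_gamma G n.+1)).
  move=> /(sub n (leqnn n)); rewrite subnn l0 => /(_ [set 1]); apply.
  by apply: open_nbhs_nbhs; split.
(* The shift makes [i = 0] give [gamma n.+1], trivial by nilpotency, and [i = n] give [gamma 1], the
   whole group. *)
pose lambda i := coset_topology (subgroup_gamma G (n - i).+1)
                                (@gamma_conj G (n - i).+1).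
exists lambda; split.
- apply: group_topology_inj; rewrite opens_coset_topology subn0 nilG.
  by apply/seteqP; split=> // A _ x m Ax ->; rewrite mulg1.
- apply: group_topology_inj; rewrite opens_coset_topology subnn.
  apply/seteqP; split=> A; last by move=> [->|->].
  move=> oA; have [[a Aa]|A0] := pselect (A !=set0).
    right; apply/seteqP; split=> // x _; rewrite -(mulVKg a x).
    exact: oA.
  by left; apply/seteqP; split=> // x Ax; case: A0; exists x.
- move=> i lin.
  have E : (n - i)%N = (n - i.+1).+1 by rewrite subnSK.
  have sub : gamma (n - i).+1 `<=` (gamma (n - i.+1).+1 : set G).
    by rewrite E; exact: gammaS.
  split.
    rewrite /coarser !opens_coset_topology => A oA x m Ax /sub.
    exact: oA.
  by apply: semitopological_coset => // g x; rewrite E; exact: gamma_comm.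
Qed.
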